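(* For the system $\dot x(t) = f(t,x(t)) + g(t,x(t))\lambda(t)u_1(t)$, $\dot\lambda(t) = \mathcal{S}\lambda(t)\omega(t)$, $\dot\omega(t) = u_2(t)$ (with $f$, $g$, $\lambda$, $\omega$, $u_1$, $u_2$ as described in the context), there exist smooth functions $x \in C^{\infty}(\mathbb{R}_{\geq 0},\mathbb{R}^n)$ that are not outer-loop trajectories of this system, i.e., there is no choice of $\lambda$, $\omega$, $u_1$, $u_2$ with the stated regularity and constraints for which $x$ satisfies the first equation. Consequently, no exact universal tracking controller (one achieving $\limsup_{t\to\infty}\|x(t)-x^\star(t)\| = 0$ for every smooth desired trajectory $x^\star$) exists for this system.
   Context: Consider a vehicle with a pivoted unidirectional actuator modeled by $\dot x = f(t,x) + g(t,x)\lambda u_1$, $\dot\lambda = \mathcal{S}\lambda\omega$, $\dot\omega = u_2$, where $x:\mathbb{R}_{\geq0}\to\mathbb{R}^n$ is the continuous outer-loop state, $f \in C^\infty(\mathbb{R}_{\geq0}\times\mathbb{R}^n,\mathbb{R}^n)$ is a smooth drift, $g\in C^\infty(\mathbb{R}_{\geq0}\times\mathbb{R}^n,\mathbb{R}^{n\times 2})$ is a smooth, bounded, uniformly full-rank actuation matrix, $\lambda \in C^1(\mathbb{R}_{\geq0},\mathbb{S}^1)$ is the actuator orientation (unit vector in $\mathbb{R}^2$), $\mathcal{S} = e_2e_1^{T} - e_1e_2^{T}$ is the $2\times2$ skew-symmetric rotation matrix, $\omega:\mathbb{R}_{\geq0}\to\mathbb{R}$ is the pivot angular velocity, $u_1:\mathbb{R}_{\geq0}\to\mathbb{R}_{\geq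 0}$ is a piecewise continuous nonnegative (unidirectional) input, and $u_2:\mathbb{R}_{\geq0}\to\mathbb{R}$ is a piecewise continuous angular acceleration input. An outer-loop trajectory is a function $x$ for which such $\lambda,\omega,u_1,u_2$ exist so that the equations hold. *)

(* Defs.v *)
From HB Require Import structures.
From mathcomp Require Import all_boot all_order all_algebra.
From mathcomp Require Import all_classical all_reals all_analysis.
Set Implicit Arguments. Unset Strict Implicit. Unset Printing Implicit Defensive.
Import Order.TTheory GRing.Theory Num.Theory.
Import numFieldNormedType.Exports.
Local Open Scope classical_set_scope.
Local Open Scope ring_scope.

Section Defs.
Variable R : realType.

Fixpoint Dseq (V W : normedModType R) (vs : seq V) (F : V -> W) : V -> W :=
  match vs with
  | [::] => F
  | v :: vs' => fun p => 'D_v (Dseq vs' F) p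
  end.

Definition smooth (V W : normedModType R) (F : V -> W) : Prop :=
  forall vs : seq V,
    continuous (Dseq vs F) /\ forall (v p : V), derivable (Dseq vs F) p v.

Definition smooth_ge0_2 (n : nat) (W : normedModType R) (F : R -> 'cV[R]_n -> W) : Prop :=
  exists G : R * 'cV[R]_n -> W,
    smooth G /\ forall t x, 0 <= t -> G (t, x) = F t x.

Definition smooth_ge0 (V : normedModType R) (F : R -> V) : Prop :=
  exists G : R -> V, smooth G /\ forall t, 0 <= t -> G t = F t.

Definition cont_ge0 (V : normedModType R) (F : R -> V) : Prop :=
  forall t : R, 0 <= t ->
    F s @[s --> within [set s : R | 0 <= s] (nbhs t)] --> F t.

Definition deriv_ge0 (V : normedModType R) (F : R -> V) (t : R) (d : V) : Prop :=
  (fun h : R => h^-1 *: (F (t + h) - F t))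
    @ within [set h : R | h != 0 /\ 0 <= t + h] (nbhs (0:R)) --> d.

Definition locfin (E : set R) : Prop :=
  forall T : R, finite_set (E `&` `[0, T]).

Definition piecewise_cont (u : R -> R) : Prop :=
  (exists E : set R, locfin E /\
     (forall t, 0 < t -> ~ E t -> {for t, continuous u}) /\
     (~ E 0 -> u s @[s --> 0^'+] --> u 0)) /\
  (forall t, 0 <= t -> exists l : R, u s @[s --> t^'+] --> l) /\
  (forall t, 0 < t -> exists l : R, u s @[s --> t^'-] --> l).

Definition Smat : 'M[R]_2 :=
  delta_mx (@Ordinal 2 1 isT) ord0 - delta_mx ord0 (@Ordinal 2 1 isT).

Definition on_S1 (l : 'cV[R]_2) : Prop :=
  l ord0 ord0 ^+ 2 + l (@Ordinal 2 1 isT) ord0 ^+ 2 = 1.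

Definition admissible_g (n : nat) (g : R -> 'cV[R]_n -> 'M[R]_(n, 2)) : Prop :=
  smooth_ge0_2 (fun t x => g t x) /\
  (exists M : R, forall t x, 0 <= t -> `|g t x| <= M) /\
  (exists c : R, 0 < c /\
     forall t x (v : 'cV[R]_2), 0 <= t -> c * `|v| <= `|g t x *m v|).

Definition outer_loop_traj (n : nat) (f : R -> 'cV[R]_n -> 'cV[R]_n)
    (g : R -> 'cV[R]_n -> 'M[R]_(n, 2)) (x : R -> 'cV[R]_n) : Prop :=
  exists (lam : R -> 'cV[R]_2) (om u1 u2 : R -> R),
    (forall t, 0 <= t -> on_S1 (lam t)) /\
    (exists dlam : R -> 'cV[R]_2,
        (forall t, 0 <= t -> deriv_ge0 lam t (dlam t)) /\ cont_ge0 dlam) /\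
    piecewise_cont u1 /\ (forall t, 0 <= t -> 0 <= u1 t) /\
    piecewise_cont u2 /\
    cont_ge0 om /\
    exists E : set R, locfin E /\
      forall t, 0 <= t -> ~ E t ->
        deriv_ge0 x t (f t (x t) + u1 t *: (g t (x t) *m lam t)) /\
        deriv_ge0 lam t (om t *: (Smat *m lam t)) /\
        deriv_ge0 om t (u2 t).

End Defs.

(* Main.v *)
Require Import Defs.
From HB Require Import structures.
From mathcomp Require Import all_boot all_order all_algebra.
From mathcomp Require Import all_classical all_reals all_analysis.
From mathcomp Require Import lra.

(** Along a trajectory, the residual [x' - f(t, x)] equals [u1 g(t, x) lambda]:
    a nonnegative multiple of a vector that moves continuously with [t] and
    never vanishes ([g] has full rank and [|lambda| = 1]).  Take
    [x(t) = (t - 1) f(1, 0) + (t - 1)^2 A].  As [f] is smooth, the residual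
    at [1 + h] is [2 h A + O(K h)] with [K] independent of [A], so at [1 + tau]
    and [1 - tau] it points along [A] and [-A] respectively.  Two nonnegative
    multiples of almost the same nonzero vector cannot do that once [|A|] is
    large compared with [K]. *)

Set Implicit Arguments.
Unset Strict Implicit.
Unset Printing Implicit Defensive.
Import Order.TTheory GRing.Theory Num.Theory.
Import numFieldNormedType.Exports.
Local Open Scope classical_set_scope.
Local Open Scope ring_scope.

Section pivoted_actuator.
Variable R : realType.

Lemma mx_entry_le_norm m p (M : 'M[R]_(m, p)) i j : `|M i j| <= `|M|.
Proof.
rewrite [leRHS]/Num.Def.normr/= mx_normrE.
by apply: le_trans; last exact: (le_bigmax _ _ (i, j)).
Qed.

Lemma mx_norm_le m p (M : 'M[R]_(m, p)) k : 0 <= k ->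
  (forall i j, `|M i j| <= k) -> `|M| <= k.
Proof.
move=> k0 Mk; rewrite [leLHS]/Num.Def.normr/= mx_normrE.
by apply: bigmax_le => // -[i j] _; exact: Mk.
Qed.

Lemma mulmx_norm_le m p q (A : 'M[R]_(m, p)) (B : 'M[R]_(p, q)) :
  `|A *m B| <= p%:R * `|A| * `|B|.
Proof.
apply: mx_norm_le => [|i j]; first by rewrite !mulr_ge0.
rewrite mxE; apply: le_trans (ler_norm_sum _ _ _) _.
rewrite -mulrA mulr_natl -[in X in _ *+ X](card_ord p) -sumr_const.
apply: ler_sum => k _; rewrite normrM.
by apply: ler_pM; rewrite ?normr_ge0 ?mx_entry_le_norm.
Qed.

Lemma cvg_mulmx (T : Type) (F : set_system T) {FF : Filter F} m p q
    (A : T -> 'M[R]_(m, p)) (B : T -> 'M[R]_(p, q))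
    (A0 : 'M[R]_(m, p)) (B0 : 'M[R]_(p, q)) :
  A @ F --> A0 -> B @ F --> B0 -> (fun t => A t *m B t) @ F --> A0 *m B0.
Proof.
move=> /cvgrPdist_lt cA /cvgrPdist_lt cB; apply/cvgrPdist_lt => e e0.
set k := p%:R * (`|A0| + `|B0| + 1) + 1.
have k0 : 0 < k by rewrite ltr_wpDl // !mulr_ge0 // !addr_ge0.
set d := Num.min 1 (e / k).
have d0 : 0 < d by rewrite lt_min ltr01 divr_gt0.
have d1 : d <= 1 by rewrite ge_min lexx.
have dk : d * k <= e by rewrite -ler_pdivlMr // ge_min lexx orbT.
near=> t.
have dA : `|A0 - A t| < d by near: t; exact: cA.
have dB : `|B0 - B t| < d by near: t; exact: cB.
have -> : A0 *m B0 - A t *m B t = (A0 - A t) *m B t + A0 *m (B0 - B t).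
  by rewrite mulmxBl mulmxBr [RHS]addrC addrA subrK.
have nB : `|B t| <= `|B0| + 1.
  by have := ler_normB B0 (B0 - B t); rewrite opprB addrC subrK; lra.
have hX : `|(A0 - A t) *m B t| <= p%:R * d * (`|B0| + 1).
  apply: le_trans (mulmx_norm_le _ _) _; rewrite -!mulrA.
  by apply: ler_wpM2l => //; apply: ler_pM => //; exact: ltW.
have hY : `|A0 *m (B0 - B t)| <= p%:R * `|A0| * d.
  apply: le_trans (mulmx_norm_le _ _) _.
  by apply: ler_wpM2l (ltW dB); rewrite mulr_ge0.
apply: le_lt_trans (ler_normD _ _) _; apply: lt_le_trans dk.
move: hX hY; rewrite /k; nra.
Unshelve. all: by end_near.
Qed.

Lemma deriv_ge0_is_derive (V : normedModType R) (X : R -> V) t d :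
  0 < t -> deriv_ge0 X t d -> is_derive t 1 X d.
Proof.
move=> t0 Xd.
have Xd1 : (fun h : R => h^-1 *: (X (h *: 1 + t) - X t)) @ 0^' --> d.
  apply: cvg_trans Xd => P [r /= r0 rP].
  exists (Num.min r t) => [|h /= hr hn0]; first by rewrite /= lt_min r0.
  move: hr; rewrite sub0r normrN lt_min => /andP[hr ht].
  rewrite [h *: 1]mulr1 [h + t]addrC; apply: (rP h).
    by rewrite /ball_ /= sub0r normrN.
  by split=> //; have := ler_norm (- h); rewrite normrN; lra.
by apply: DeriveDef; [apply/cvg_ex; exists d | exact: cvg_lim].
Qed.

Lemma is_derive_scalel (V W : normedModType R) (k : V -> R) (b : W) x v dk :
  is_derive x v k dk -> is_derive x v (fun z => k z *: b) (dk *: b).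
Proof.
move=> [kd <-].
have lim : (fun h : R => h^-1 *: (k (h *: v + x) *: b - k x *: b)) @ 0^'
           --> 'D_v k x *: b.
  under eq_fun do rewrite -scalerBl scalerA.
  exact: cvgZr_tmp kd.
by apply: DeriveDef; [apply/cvg_ex; exists ('D_v k x *: b) | exact: cvg_lim].
Qed.

Definition quad (V : normedModType R) (s : R) (a b c : V) (t : R) : V :=
  a + (t - s) *: b + (t - s) ^+ 2 *: c.

Lemma is_derive_quad (V : normedModType R) s (a b c : V) t v :
  is_derive t v (quad s a b c) (quad s (v *: b) ((2 * v) *: c) 0 t).
Proof.
have dlin : is_derive t v (fun r : R => r - s) v.
  by apply: is_derive_eq; rewrite subr0.
have dsq : is_derive t v (fun r : R => (r - s) ^+ 2) ((2 * (t - s)) * v).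
  by have := is_deriveX 2 dlin; rewrite /= expr1.
apply: is_derive_eq (is_deriveD (is_deriveD (is_derive_cst a t v)
  (is_derive_scalel b dlin)) (is_derive_scalel c dsq)) _.
by rewrite add0r /quad scaler0 addr0 scalerA mulrCA mulrA.
Qed.

Lemma Dseq_quad (V : normedModType R) s (a b c : V) (vs : seq R) :
  exists a' b' c', Dseq vs (quad s a b c) = quad s a' b' c'.
Proof.
elim: vs => [|v vs [a' [b' [c' IH]]]]; first by exists a, b, c.
exists (v *: b'), ((2 * v) *: c'), 0; rewrite /= IH.
by apply/funext => t; have [_ ->] := is_derive_quad s a' b' c' t v.
Qed.

Lemma smooth_quad (V : normedModType R) s (a b c : V) : smooth (quad s a b c).
Proof.
move=> vs; have [a' [b' [c' ->]]] := Dseq_quad s a b c vs.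
split=> [t|v t]; last by have [] := is_derive_quad s a' b' c' t v.
apply/differentiable_continuous/derivable1_diffP.
by have [] := is_derive_quad s a' b' c' t 1.
Qed.

Lemma ler_dist_deriv (phi phi' : R -> R) (a b M : R) : a <= b ->
  (forall s : R, is_derive s 1 phi (phi' s)) ->
  (forall s, a <= s <= b -> `|phi' s| <= M) ->
  `|phi b - phi a| <= M * (b - a).
Proof.
move=> ab dphi bphi.
have cphi : {within `[a, b], continuous phi}.
  by apply: derivable_within_continuous => s _; have [] := dphi s.
have [c /[!in_itv]/= cab ->] := MVT_segment ab (fun s _ => dphi s) cphi.
by rewrite normrM [`|b - a|]ger0_norm ?subr_ge0 // ler_wpM2r ?subr_ge0 ?bphi.
Qed.

Lemma is_derive_line_entry (V : normedModType R) m p (G : V -> 'M[R]_(m, p))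
    (y d : V) (s : R) i j :
  derivable G (y + s *: d) d ->
  is_derive s 1 (fun s : R => G (y + s *: d) i j) ('D_d G (y + s *: d) i j).
Proof.
move=> dG.
have shiftE : (fun h : R => h^-1 *: (G (y + (h *: 1 + s) *: d) - G (y + s *: d)))
  = (fun h : R => h^-1 *: (G (h *: d + (y + s *: d)) - G (y + s *: d))).
  apply/funext => h; congr (_ *: (G _ - _)).
  by rewrite [h *: 1]mulr1 scalerDl addrCA addrA addrC.
have dline : derivable (fun s : R => G (y + s *: d)) s 1.
  by rewrite /derivable /= shiftE.
have Dline : 'D_1 (fun s : R => G (y + s *: d)) s = 'D_d G (y + s *: d).
  by rewrite /derive /= shiftE.
apply: DeriveDef; first exact: (derivable_mxP _ _ _).1 dline i j.
by rewrite -Dline (derive_mx dline) mxE.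
Qed.

Lemma directional_lipschitz (V : normedModType R) m p (G : V -> 'M[R]_(m, p))
    (q0 d : V) :
  (forall q, derivable G q d) -> {for q0, continuous (fun q => 'D_d G q)} ->
  exists2 K : R, 0 <= K & exists2 r : R, 0 < r & forall y (sg : R),
    `|y - q0| < r -> `|sg| * `|d| < r -> `|G (y + sg *: d) - G y| <= K * `|sg|.
Proof.
move=> dG /cvgrPdist_lt /(_ 1 ltr01) /nbhs_ballP [r /= r0 Dr].
exists (`|'D_d G q0| + 1); first by rewrite addr_ge0.
exists (r / 2) => [|y sg yr sgr]; first by rewrite divr_gt0.
have Dbound s i j : `|s| <= `|sg| -> `|'D_d G (y + s *: d) i j| <= `|'D_d G q0| + 1.
  move=> s_sg; apply: le_trans (mx_entry_le_norm _ _ _) _.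
  have /Dr : ball q0 r (y + s *: d).
    rewrite -ball_normE /= opprD addrA; apply: le_lt_trans (ler_normD _ _) _.
    rewrite distrC normrN normrZ.
    have : `|s| * `|d| <= `|sg| * `|d| by rewrite ler_wpM2r.
    lra.
  move=> Dlt; have := ler_normB ('D_d G q0) ('D_d G q0 - 'D_d G (y + s *: d)).
  by rewrite opprB addrC subrK; lra.
apply: mx_norm_le => [|i j]; first by rewrite mulr_ge0 ?addr_ge0.
rewrite !mxE.
have dphi (s : R) := is_derive_line_entry i j (dG (y + s *: d)).
have [sg0|sg0] := leP 0 sg.
- have := ler_dist_deriv (M := `|'D_d G q0| + 1) sg0 dphi.
  rewrite scale0r addr0 subr0 [`|sg|]ger0_norm //; apply => s /andP[s0 s_sg].
  by apply: Dbound; rewrite !ger0_norm.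
- have := ler_dist_deriv (M := `|'D_d G q0| + 1) (ltW sg0) dphi.
  rewrite scale0r addr0 distrC sub0r [`|sg|]ltr0_norm //; apply => s /andP[sg_s s0].
  by apply: Dbound; rewrite ler0_norm // ltr0_norm // lerN2.
Qed.

Lemma derivable_dist_le (V W : normedModType R) (G : V -> W) (q0 d : V) :
  derivable G q0 d ->
  \forall h \near (0 : R), `|G (q0 + h *: d) - G q0| <= (`|'D_d G q0| + 1) * `|h|.
Proof.
move=> /cvgrPdist_le /(_ 1 ltr01); rewrite near_withinE => Dnear.
near=> h.
have Dh : h != 0 -> `|'D_d G q0 - h^-1 *: (G (h *: d + q0) - G q0)| <= 1.
  by near: h.
have [->|h0] := eqVneq h 0; first by rewrite scale0r addr0 subrr !normr0 mulr0.
rewrite [q0 + _]addrC; move: (G _ - _) (Dh h0) => D DD.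
have -> : D = h *: (h^-1 *: D) by rewrite scalerA mulfV // scale1r.
rewrite normrZ mulrC ler_wpM2r //.
have := ler_normB ('D_d G q0) ('D_d G q0 - h^-1 *: D).
by rewrite opprB addrC subrK; lra.
Unshelve. all: by end_near.
Qed.

Lemma near0_normM_lt (k e : R) : 0 <= k -> 0 < e ->
  \forall t \near (0 : R), `|t| * k < e.
Proof.
move=> k0 e0; have k1 : 0 < k + 1 by rewrite ltr_wpDl.
exists (e / (k + 1)) => [|t /=]; first by rewrite /= divr_gt0.
rewrite sub0r normrN ltr_pdivlMr // => te; apply: le_lt_trans te.
by rewrite ler_wpM2l // lerDl.
Qed.

Lemma curve_lipschitz (V : normedModType R) m p (G : V -> 'M[R]_(m, p))
    (q0 d : V) : smooth G ->
  exists2 K : R, 0 <= K & forall w : V,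
    \forall t \near (0 : R), `|G (q0 + t *: d + t ^+ 2 *: w) - G q0| <= K * `|t|.
Proof.
move=> sG; exists (`|'D_d G q0| + 2) => [|w]; first by rewrite addr_ge0.
have [K K0 [r r0 Lw]] := directional_lipschitz ((sG [::]).2 w) ((sG [:: w]).1 q0).
near=> t.
have t1 : `|t| <= 1.
  by rewrite -[`|t|]mulr1 ltW //; near: t; exact: near0_normM_lt.
have tK : `|t| * K < 1 by near: t; exact: near0_normM_lt.
have td : `|t| * `|d| < r by near: t; exact: near0_normM_lt.
have tw : `|t| * `|w| < r by near: t; exact: near0_normM_lt.
have t2 : `|t ^+ 2| = `|t| * `|t| by rewrite normrX expr2.
have Ld : `|G (q0 + t *: d) - G q0| <= (`|'D_d G q0| + 1) * `|t|.
  by near: t; exact: derivable_dist_le ((sG [::]).2 d q0).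
(* The [t^2 w] displacement costs [K t^2 <= |t|], whence a constant free of [w]. *)
have Lt : `|G (q0 + t *: d + t ^+ 2 *: w) - G (q0 + t *: d)| <= K * `|t ^+ 2|.
  apply: Lw; first by rewrite addrC addKr normrZ.
  by rewrite t2 -mulrA; apply: le_lt_trans tw; rewrite ler_piMl ?mulr_ge0.
apply: le_trans (ler_distD (G (q0 + t *: d)) _ _) _.
rewrite t2 in Lt; have := normr_ge0 t; nra.
Unshelve. all: by end_near.
Qed.

Lemma near_dnbhs0_notin (s : seq R) (t : R) :
  \forall h \near (0 : R)^', t + h \notin s.
Proof.
elim: s => [|y s IH]; first by near=> h.
have yP : \forall h \near (0 : R)^', t + h != y.
  have [->|yt] := eqVneq y t.
    apply: filterS (nbhs_dnbhs_neq 0) => h h0.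
    by rewrite -subr_eq0 addrAC subrr add0r.
  have yt0 : 0 < `|y - t| by rewrite normr_gt0 subr_eq0.
  apply: cvg_within; exists `|y - t| => // h /= ht.
  by apply: contraTneq ht => <-; rewrite sub0r normrN addrC addKr ltxx.
near=> h; rewrite in_cons negb_or; apply/andP.
by split; near: h; [exact: yP | exact: IH].
Unshelve. all: by end_near.
Qed.

Lemma locfin_dnbhs (E : set R) (t : R) : 0 < t -> locfin E ->
  \forall h \near (0 : R)^', ~ E (t + h).
Proof.
move=> t0 /(_ (t + 1)) /finite_seqP [s sE].
near=> h.
have hs : t + h \notin s by near: h; exact: near_dnbhs0_notin.
have ht : `|h| < Num.min t 1.
  by near: h; apply: cvg_within; apply: (@nbhs0_lt _ R^o); rewrite lt_min t0 ltr01.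
move=> Eth; move/negP: hs; apply.
suff : [set` s] (t + h) by [].
rewrite -sE; split=> //=; rewrite in_itv /=; move: ht; rewrite lt_min => /andP[].
by have := ler_norm h; have := ler_norm (- h); rewrite normrN; lra.
Unshelve. all: by end_near.
Qed.

Lemma dnbhs0_sym_witness (P : R -> Prop) :
  (\forall h \near (0 : R)^', P h) -> exists2 t : R, 0 < t & P t /\ P (- t).
Proof.
move=> [r /= r0 rP]; exists (r / 2); first by rewrite divr_gt0.
have r2 : r / 2 < r by rewrite ltr_pdivrMr //; lra.
split; apply: rP; rewrite /= ?sub0r ?normrN ?opprK ?gtr0_norm ?divr_gt0 //.
- by rewrite gt_eqF ?divr_gt0.
- by rewrite oppr_eq0 gt_eqF ?divr_gt0.
Qed.

Lemma norm_le_of_opposite_rays (W : normedModType R) (G0 Gp Gm Dp Dm A : W)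
    (a b t K : R) :
  0 < t -> 0 <= a -> 0 <= b -> `|Dp| <= K * t -> `|Dm| <= K * t ->
  a *: Gp = Dp + t *: A -> b *: Gm = Dm - t *: A ->
  2 * `|Gp - G0| <= `|G0| -> 2 * `|Gm - G0| <= `|G0| ->
  `|A| <= 7 * K.
Proof.
move=> t0 a0 b0 Dpt Dmt ep em Gp0 Gm0.
(* Summing the two rays cancels [A] and bounds [a + b]; the first ray then
   bounds [t |A|]. *)
have split_rays : Dp + Dm = (a + b) *: G0 + (a *: (Gp - G0) + b *: (Gm - G0)).
  have -> : Dp + Dm = a *: Gp + b *: Gm by rewrite ep em addrACA subrr addr0.
  rewrite scalerDl !scalerBr addrACA.
  by rewrite [a *: G0 + _]addrC [b *: G0 + _]addrC !subrK.
have ab_small : (a + b) * `|G0| <= 4 * K * t.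
  have := ler_normB (Dp + Dm) (a *: (Gp - G0) + b *: (Gm - G0)).
  rewrite {1}split_rays addrK normrZ ger0_norm ?addr_ge0 //.
  have := ler_normD Dp Dm; have := ler_normD (a *: (Gp - G0)) (b *: (Gm - G0)).
  rewrite !normrZ !ger0_norm //.
  have : a * (2 * `|Gp - G0|) <= a * `|G0| by rewrite ler_wpM2l.
  have : b * (2 * `|Gm - G0|) <= b * `|G0| by rewrite ler_wpM2l.
  lra.
have Gp_le : 2 * `|Gp| <= 3 * `|G0|.
  by have := ler_normD (Gp - G0) G0; rewrite subrK; lra.
have : t * `|A| <= 7 * K * t.
  have -> : t * `|A| = `|a *: Gp - Dp| by rewrite ep addrC addKr normrZ gtr0_norm.
  apply: le_trans (ler_normB _ _) _; rewrite normrZ ger0_norm //.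
  have : a * (2 * `|Gp|) <= a * (3 * `|G0|) by rewrite ler_wpM2l.
  have := normr_ge0 G0; nra.
by rewrite [7 * K * t]mulrC ler_pM2l.
Qed.

Lemma on_S1_neq0 (l : 'cV[R]_2) : on_S1 l -> l != 0.
Proof.
rewrite /on_S1 => l1; apply: contra_eq_neq l1 => ->.
by rewrite !mxE expr0n /= add0r eq_sym oner_neq0.
Qed.

Lemma outer_loop_traj_accel_le n (f : R -> 'cV[R]_n -> 'cV[R]_n)
    (g : R -> 'cV[R]_n -> 'M[R]_(n, 2)) (gx : R -> 'M[R]_(n, 2))
    (x : R -> 'cV[R]_n) (t0 K : R) (D A : 'cV[R]_n) :
  0 < t0 -> (forall t, 0 <= t -> g t (x t) = gx t) -> {for t0, continuous gx} ->
  (forall v : 'cV[R]_2, v != 0 -> gx t0 *m v != 0) ->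
  (forall h, is_derive (t0 + h) 1 x (D + h *: A)) ->
  (\forall h \near 0, `|D - f (t0 + h) (x (t0 + h))| <= K * `|h|) ->
  outer_loop_traj f g x -> `|A| <= 7 * K.
Proof.
move=> t00 ggx gx_cont gx_inj dx fK.
move=> [lam [om [u1 [u2 [lamS1 [[dlam [dlamE _]] [_ [u1_ge0 [_ [_ traj0]]]]]]]]]].
move: traj0 => [E [Efin traj]].
set G := fun t => gx t *m lam t.
have G_cont : G @ t0 --> G t0.
  apply: cvg_mulmx => //.
  have [lam_t0 _] := deriv_ge0_is_derive t00 (dlamE _ (ltW t00)).
  exact/differentiable_continuous/derivable1_diffP/lam_t0.
have G0 : 0 < `|G t0|.
  by rewrite normr_gt0; apply/gx_inj/on_S1_neq0/lamS1/ltW.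
have thrust h : 0 < t0 + h -> ~ E (t0 + h) ->
    u1 (t0 + h) *: G (t0 + h) = (D - f (t0 + h) (x (t0 + h))) + h *: A.
  move=> th Eh; have [+ _] := traj _ (ltW th) Eh.
  move=> /(deriv_ge0_is_derive th) [_]; have [_ ->] := dx h.
  rewrite ggx; last exact: ltW.
  move=> eq.
  by rewrite /G -[LHS](addKr (f (t0 + h) (x (t0 + h)))) -eq addrCA addrA.
have : \forall h \near (0 : R)^', [/\ 0 < t0 + h, ~ E (t0 + h),
    `|D - f (t0 + h) (x (t0 + h))| <= K * `|h|
  & 2 * `|G (t0 + h) - G t0| <= `|G t0|].
  move/cvgrPdist_le: G_cont => /(_ _ (divr_gt0 G0 (ltr0Sn _ 1))) /nbhs0P G_near.
  near=> h; split.
  - have : `|h| < t0 by near: h; apply: cvg_within; exact: (@nbhs0_lt _ R^o).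
    by have := ler_norm (- h); rewrite normrN; lra.
  - by near: h; exact: locfin_dnbhs.
  - by near: h; apply: cvg_within.
  - have : `|G t0 - G (t0 + h)| <= `|G t0| / 2 by near: h; apply: cvg_within.
    by rewrite distrC; lra.
move=> /dnbhs0_sym_witness [tau tau0 [[tp Ep fp Gp] [tm Em fm Gm]]].
apply: (norm_le_of_opposite_rays (G0 := G t0) (Gp := G (t0 + tau))
  (Gm := G (t0 - tau)) (Dp := D - f (t0 + tau) (x (t0 + tau)))
  (Dm := D - f (t0 - tau) (x (t0 - tau))) (a := u1 (t0 + tau))
  (b := u1 (t0 - tau)) tau0) => //.
- exact/u1_ge0/ltW.
- exact/u1_ge0/ltW.
- by move: fp; rewrite gtr0_norm.
- by move: fm; rewrite normrN gtr0_norm.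
- exact: thrust.
- by rewrite thrust // scaleNr.
Unshelve. all: by end_near.
Qed.

Lemma quad_pairE (V : normedModType R) (s : R) (a b c : V) (h : R) :
  (s + h, quad s a b c (s + h)) = (s, a) + h *: (1, b) + h ^+ 2 *: (0, c).
Proof.
rewrite /quad; have -> : s + h - s = h by rewrite addrC addKr.
by congr (_, _) => /=; rewrite ?[h *: 1]mulr1 ?[_ *: 0]mulr0 !addr0.
Qed.

Lemma is_derive_quad_at (V : normedModType R) (s : R) (a b c : V) (h : R) :
  is_derive (s + h) 1 (quad s a b c) (b + h *: (2 *: c)).
Proof.
have := is_derive_quad s a b c (s + h) 1.
rewrite /quad; have -> : s + h - s = h by rewrite addrC addKr.
by rewrite scale1r mulr1 scaler0 addr0.
Qed.

Lemma quad_residual_le n (f : R -> 'cV[R]_n -> 'cV[R]_n) (s : R) :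
  0 < s -> smooth_ge0_2 f ->
  exists2 K : R, 0 <= K & forall A : 'cV[R]_n, \forall h \near 0,
    `|f s 0 - f (s + h) (quad s 0 (f s 0) A (s + h))| <= K * `|h|.
Proof.
move=> s0 [G [G_smooth Gf]].
have [K K0 GK] := curve_lipschitz (G := G) (s, 0) (1, f s 0) G_smooth.
exists K => // A; near=> h.
have sh : 0 <= s + h.
  have : `|h| < s by near: h; exact: (@nbhs0_lt _ R^o).
  by have := ler_norm (- h); rewrite normrN; lra.
rewrite -[X in `|X - _|](Gf s 0 (ltW s0)) -(Gf (s + h)) // distrC quad_pairE.
by near: h; exact: GK.
Unshelve. all: by end_near.
Qed.

Lemma admissible_g_inj n (g : R -> 'cV[R]_n -> 'M[R]_(n, 2)) :
  admissible_g g -> forall t y (v : 'cV[R]_2), 0 <= t -> v != 0 -> g t y *m v != 0.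
Proof.
move=> [_ [_ [c [c0 g_lower]]]] t y v t0 v0; rewrite -normr_gt0.
by apply: lt_le_trans (g_lower _ _ _ t0); rewrite mulr_gt0 ?normr_gt0.
Qed.

Lemma admissible_g_along n (g : R -> 'cV[R]_n -> 'M[R]_(n, 2)) (x : R -> 'cV[R]_n) :
  admissible_g g -> continuous x ->
  exists2 gx : R -> 'M[R]_(n, 2),
    forall t, 0 <= t -> g t (x t) = gx t & continuous gx.
Proof.
move=> [[G [G_smooth Gg]] _] x_cont; exists (fun t => G (t, x t)) => [t t0|t].
  by rewrite Gg.
apply: (continuous_comp (f := fun t => (t, x t))); last exact: (G_smooth [::]).1.
exact: cvg_pair cvg_id (x_cont t).
Qed.

Lemma normrZ_normalize (V : normedModType R) (v : V) (r : R) :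
  v != 0 -> 0 <= r -> `|(r / `|v|) *: v| = r.
Proof.
move=> v0 r0; rewrite normrZ normrM normfV normr_id ger0_norm //.
by rewrite -mulrA mulVf ?mulr1 // normr_eq0.
Qed.

End pivoted_actuator.

Theorem theorem1 (R : realType) (n : nat)
    (f : R -> 'cV[R]_n -> 'cV[R]_n) (g : R -> 'cV[R]_n -> 'M[R]_(n, 2)) :
  smooth_ge0_2 f -> admissible_g g ->
  exists x : R -> 'cV[R]_n, smooth_ge0 x /\ ~ outer_loop_traj f g x.
Proof.
move=> f_smooth g_adm.
have [K K0 fK] := quad_residual_le ltr01 f_smooth.
(* The rank condition provides a nonzero vector of [R^n]; [A] is any vector
   with [|2 A| > 7 K]. *)
pose v0 := g 1 0 *m (const_mx 1 : 'cV[R]_2).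
have v0_neq0 : v0 != 0.
  apply: (admissible_g_inj g_adm) => //; apply/eqP => /matrixP /(_ ord0 ord0) /eqP.
  by rewrite !mxE oner_eq0.
pose A := ((4 * K + 1) / `|v0|) *: v0.
pose x := quad 1 0 (f 1 0) A.
have x_smooth : smooth x := smooth_quad 1 0 (f 1 0) A.
exists x; split=> [|traj]; first by exists x.
have [gx ggx gx_cont] := admissible_g_along g_adm (x_smooth [::]).1.
suff : `|2 *: A| <= 7 * K.
  by rewrite normrZ normrZ_normalize ?addr_ge0 ?mulr_ge0 // ger0_norm //; lra.
apply: (outer_loop_traj_accel_le ltr01 ggx (gx_cont 1) _
         (is_derive_quad_at 1 0 _ _) (fK A) traj).
by move=> v v_neq0; rewrite -ggx //; exact: admissible_g_inj.
Qed.
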